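(* Let two interacting particles $P_1,P_2$ of masses $m_1,m_2$ move relative to a non-inertial frame rotating with angular velocity $\vec\omega$, an arbitrary differentiable vector-valued function of time, with $\vec\omega_0=\vec\omega(0)$. Let their position vectors $\vec r_1,\vec r_2$ in this frame satisfy $$m_1\left[\ddot{\vec r}_1+2\vec\omega\times\dot{\vec r}_1+\vec\omega\times(\vec\omega\times\vec r_1)+\dot{\vec\omega}\times\vec r_1\right]=\vec F_{12},$$ $$m_2\left[\ddot{\vec r}_2+2\vec\omega\times\dot{\vec r}_2+\vec\omega\times(\vec\omega\times\vec r_2)+\dot{\vec\omega}\times\vec r_2\right]=\vec F_{21},$$ with initial conditions $\vec r_k(0)=\vec r_k^{\,0}$, $\dot{\vec r}_k(0)=\vec v_k^{\,0}$, $k=1,2$, where the interaction forces obey the principle of mutual actions $$\vec F_{12}+\vec F_{21}=\vec 0,\qquad \vec F_{12}\times(\vec r_2-\vec r_1)=\vec 0,$$ so that, with $\vec r=\vec r_2-\vec r_1$ and $r=\|\vec r\|$, one has $\vec F_{21}=F\,\dfrac{\vec r}{r}$, where $F$ is a scalar function. Put $$\vec r_c=\frac{m_1\vec r_1+m_2\vec r_2}{m_1+m_2},\quad \vec r_c^{\,0}=\frac{m_1\vec r_1^{\,0}+m_2\vec r_2^{\,0}}{m_1+m_2},\quad \vec v_c^{\,0}=\frac{m_1\vec v_1^{\,0}+m_2\vec v_2^{\,0}}{m_1+m_2},$$ $$\vec r^{\,0}=\vec r_2^{\,0}-\vec r_1^{\,0},\quad \vec v^{\,0}=\vec v_2^{\,0}-\vec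 v_1^{\,0},\quad m=\frac{m_1m_2}{m_1+m_2}.$$ Let $\vec r_c^{\,*}$ be the solution of $$\ddot{\vec r}_c^{\,*}=\vec 0,\qquad \vec r_c^{\,*}(0)=\vec r_c^{\,0},\qquad \dot{\vec r}_c^{\,*}(0)=\vec v_c^{\,0}+\vec\omega_0\times\vec r_c^{\,0},$$ that is, $\vec r_c^{\,*}(t)=\vec r_c^{\,0}+(\vec v_c^{\,0}+\vec\omega_0\times\vec r_c^{\,0})t$, and let $\vec r^{\,*}$ be the solution of $$\ddot{\vec r}^{\,*}=\frac{F}{m}\,\frac{\vec r^{\,*}}{r^*},\qquad \vec r^{\,*}(0)=\vec r^{\,0},\qquad \dot{\vec r}^{\,*}(0)=\vec v^{\,0}+\vec\omega_0\times\vec r^{\,0},\qquad r^*=\|\vec r^{\,*}\|.$$ Then $\vec r_c=F_{-\omega}(\vec r_c^{\,*})$ and $\vec r=F_{-\omega}(\vec r^{\,*})$, and the laws of motion of the two particles in the non-inertial frame are $$\vec r_1=F_{-\omega}\!\left(\vec r_c^{\,*}-\frac{m_2}{m_1+m_2}\vec r^{\,*}\right),\qquad \vec r_2=F_{-\omega}\!\left(\vec r_c^{\,*}+\frac{m_1}{m_1+m_2}\vec r^{\,*}\right).$$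
   Context: Vectors are in oriented Euclidean three-space; the dot denotes $d/dt$, and $t\ge 0$. $\vec F_{ij}$ is the force acting on particle $P_i$ due to its interaction with $P_j$. $\widetilde\omega(t)$ is the skew-symmetric second-order tensor with $\widetilde\omega(t)\vec x=\vec\omega(t)\times\vec x$. The rotation tensor with angular velocity $-\vec\omega$ is the operator $F_{-\omega}$ on vector-valued functions of time given by $F_{-\omega}(\vec x)(t)=Q(t)\vec x(t)$, where $Q$ is the unique solution of $\dot Q=-\widetilde\omega Q$, $Q(0)=I_3$ (a proper orthogonal tensor for every $t$). *)

(* Defs.v *)
From HB Require Import structures.
From mathcomp Require Import all_boot all_order all_algebra.
From mathcomp Require Import all_classical all_reals all_analysis.

Set Implicit Arguments.
Unset Strict Implicit.
Unset Printing Implicit Defensive.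

Import Order.TTheory GRing.Theory Num.Theory.
Import numFieldNormedType.Exports.

Local Open Scope classical_set_scope.
Local Open Scope ring_scope.

(* [df] is the time derivative of [f] on the half-line [0, +oo[: two-sided at
   every t > 0 and one-sided at t = 0.  Values at negative times are ignored. *)
Definition is_dot (R : realType) (V : normedModType R) (f df : R -> V) : Prop :=
  forall t : R, 0 <= t ->
    (s - t)^-1 *: (f s - f t) @[s --> within [set s | 0 <= s] t^'] --> df t.

(* Vectors are coordinate columns in a positively oriented orthonormal basis.
   The library norm `|x| on columns is the sup norm, hence [enorm]. *)
Definition enorm (R : realType) (x : 'cV[R]_3) : R :=
  Num.sqrt (\sum_i x i 0 ^+ 2).

(* Indices are added in Z/3. *)
Definition cross (R : realType) (u v : 'cV[R]_3) : 'cV[R]_3 :=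
  \col_(i < 3) (u (i + 1) 0 * v (i + 2%:R) 0 - u (i + 2%:R) 0 * v (i + 1) 0).

(* The j-th column is w x e_j. *)
Definition skew (R : realType) (w : 'cV[R]_3) : 'M[R]_3 :=
  \matrix_(i, j) cross w (delta_mx j 0) i 0.

Lemma mul_skew (R : realType) (w x : 'cV[R]_3) : skew w *m x = cross w x.
Proof.
have S k : \sum_j (k == j)%:R * x j 0 = x k 0.
  by under eq_bigr do rewrite mulr_natl mulrb eq_sym; rewrite -big_mkcond big_pred1_eq.
apply/matrixP => i k; rewrite [k]ord1 !mxE.
under eq_bigr => j _ do rewrite !mxE !eqxx !andbT mulrBl -!mulrA.
by rewrite sumrB -!mulr_sumr !S.
Qed.

(* [Q] is the rotation tensor with angular velocity - w. *)
Definition is_rotation_neg (R : realType) (w : R -> 'cV[R]_3)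
    (Q : R -> 'M[R]_3) : Prop :=
  is_dot Q (fun t => - skew (w t) *m Q t) /\ Q 0 = 1%:M.

(* The operator F_{-w} attached to the rotation tensor [Q]. *)
Definition rotate (R : realType) (Q : R -> 'M[R]_3) (x : R -> 'cV[R]_3) :
    R -> 'cV[R]_3 :=
  fun t => Q t *m x t.

Definition barycenter (R : realType) (m1 m2 : R) (x1 x2 : 'cV[R]_3) : 'cV[R]_3 :=
  (m1 + m2)^-1 *: (m1 *: x1 + m2 *: x2).

Definition reduced_mass (R : realType) (m1 m2 : R) : R := m1 * m2 / (m1 + m2).

Definition is_free_motion (R : realType) (x0 v0 : 'cV[R]_3) (x : R -> 'cV[R]_3) :
    Prop :=
  exists v : R -> 'cV[R]_3,
    [/\ is_dot x v, is_dot v (fun=> 0), x 0 = x0 & v 0 = v0].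

(* Motion under the central force F x / |x|.  The scalar F may depend on time
   and on the distance |x|; the equation only makes sense where x <> 0. *)
Definition is_central_motion (R : realType) (m : R) (F : R -> R -> R)
    (x0 v0 : 'cV[R]_3) (x : R -> 'cV[R]_3) : Prop :=
  (forall t : R, 0 <= t -> x t <> 0) /\
  exists v : R -> 'cV[R]_3,
    [/\ is_dot x v,
        is_dot v (fun t => (F t (enorm (x t)) / m) *: ((enorm (x t))^-1 *: x t)),
        x 0 = x0 & v 0 = v0].

(* "x is the solution": it satisfies [P], and any other function satisfying [P]
   has the same values at all times t >= 0. *)
Definition is_the_solution (R : realType) (V : Type) (P : (R -> V) -> Prop)
    (x : R -> V) : Prop :=
  P x /\ forall y, P y -> forall t : R, 0 <= t -> y t = x t.

(* Main.v *)
Require Import Defs.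
From mathcomp Require Import all_boot all_order all_algebra.
From mathcomp Require Import all_classical all_reals all_analysis.
From mathcomp Require Import ring.
Import numFieldNormedType.Exports.
Local Open Scope ring_scope.

(** Multiplying by the transpose of the rotation tensor Q undoes the rotation
    of the frame: in the coordinates y_k = Q^T r_k the inertial terms disappear
    and Newton's equations take the form m_k y_k'' = Q^T F_k.

    Because Q' = - W Q with W skew-symmetric, the derivative of Q^T Q is zero,
    so Q^T Q stays equal to its initial value, the identity ([rotationTK]).
    The same equation gives (Q^T x)' = Q^T (x' + cross w x)
    ([is_dot_unrotate]).  Using this rule twice produces exactly the Coriolis,
    centrifugal and Euler terms ([is_dot_unrotate_velocity]).

    By the law of action and reaction the barycenter of y_1 and y_2 is then a
    free motion, and a free motion is determined by its initial data
    ([free_motionE]); hence it equals r_c^*.  The difference y_2 - y_1 obeys the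
    central equation with the reduced mass, because 1/m_1 + 1/m_2 = 1/m, Q^T
    commutes with scalars and preserves the Euclidean norm
    ([enorm_orthogonal]); by the uniqueness part of the definition of r^* it
    equals r^*.  Multiplying by Q gives the claims on r_c and r, and the two
    positions are recovered from the barycenter and the difference
    ([barycenter_left], [barycenter_right]). *)

Import Order.TTheory GRing.Theory Num.Theory.
Local Open Scope classical_set_scope.

(* Importing the libraries hides the tensor [skew] behind the abbreviation of the
   same name for skew-symmetric forms. *)
Local Notation skew := Defs.skew.

(** * Limits of matrix-valued functions *)

Lemma cvg_mxP {R : realType} {T : Type} (F : set_system T) {FF : Filter F}
    {m n : nat} (f : T -> 'M[R]_(m, n)) (l : 'M[R]_(m, n)) :
  f @ F --> l <-> forall i j, (f x i j @[x --> F] --> l i j).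
Proof.
split=> [fl i j|fl].
  exact: (cvg_comp _ (fun M : 'M[R]_(m, n) => M i j) fl
    (@coord_continuous _ _ _ i j l)).
move=> A [P Pl PA]; apply: (filterS (fun x h => PA (f x) h)).
apply: filter_forall => i; apply: filter_forall => j.
exact: (fl i j (P i j)).
Qed.

Lemma cvg_mulmx {R : realType} {T : Type} (F : set_system T) {FF : Filter F}
    {m n p : nat} (f : T -> 'M[R]_(m, n)) (g : T -> 'M[R]_(n, p))
    (a : 'M[R]_(m, n)) (b : 'M[R]_(n, p)) :
  f @ F --> a -> g @ F --> b -> (f x *m g x) @[x --> F] --> a *m b.
Proof.
move=> /cvg_mxP fa /cvg_mxP gb; apply/cvg_mxP => i j.
rewrite mxE; under eq_fun do rewrite mxE.
apply: cvg_big => [|k _]; [exact: add_continuous|by apply: cvgM].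
Qed.

(** * Differentiation on the half-line *)

Section HalfLineDerivative.
Context {R : realType}.

(** A differentiable function is continuous:
    f s = f t + (s - t) * (difference quotient), and s - t tends to 0. *)
Lemma is_dot_cvg {V : normedModType R} (f df : R -> V) (t : R) :
  is_dot f df -> 0 <= t -> f s @[s --> within [set s | 0 <= s] t^'] --> f t.
Proof.
move=> fdf t0.
have st : (s - t) @[s --> within [set s | 0 <= s] t^'] --> 0.
  rewrite -[X in _ --> X](subrr t); apply: cvgB; last exact: cvg_cst.
  apply: cvg_trans (@nbhs_dnbhs _ t); exact: cvg_within.
have h : (f t + (s - t) *: ((s - t)^-1 *: (f s - f t)))
    @[s --> within [set s | 0 <= s] t^'] --> f t + 0 *: df t.
  by apply: cvgD; [exact: cvg_cst|apply: cvgZ => //; exact: fdf].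
rewrite scale0r addr0 in h; apply: cvg_trans h; apply: near_eq_cvg.
rewrite near_withinE /dnbhs near_withinE; near=> s => st' _.
by rewrite scalerA divff ?subr_eq0// scale1r addrCA subrr addr0.
Unshelve. all: by end_near. Qed.

Lemma eq_is_dot {V : normedModType R} (f g df dg : R -> V) :
  (forall t, 0 <= t -> f t = g t) -> (forall t, 0 <= t -> df t = dg t) ->
  is_dot f df -> is_dot g dg.
Proof.
move=> fg dfg fdf t t0; rewrite -dfg// -fg//.
apply: cvg_trans (fdf _ t0); apply: near_eq_cvg.
by rewrite near_withinE; near=> s => s0; rewrite fg.
Unshelve. all: by end_near. Qed.

Lemma is_dotD {V : normedModType R} (f g df dg : R -> V) :
  is_dot f df -> is_dot g dg -> is_dot (fun t => f t + g t) (fun t => df t + dg t).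
Proof.
move=> fdf gdg t t0.
apply: cvg_trans (cvgD (fdf _ t0) (gdg _ t0)); apply: near_eq_cvg.
by near=> s; rewrite !fctE -scalerDr opprD addrACA.
Unshelve. all: by end_near. Qed.

Lemma is_dotZ {V : normedModType R} (k : R) (f df : R -> V) :
  is_dot f df -> is_dot (fun t => k *: f t) (fun t => k *: df t).
Proof.
move=> fdf t t0; apply: cvg_trans (cvgZ (cvg_cst k) (fdf _ t0)); apply: near_eq_cvg.
by near=> s; rewrite -scalerBr !scalerA mulrC.
Unshelve. all: by end_near. Qed.

Lemma is_dotB {V : normedModType R} (f g df dg : R -> V) :
  is_dot f df -> is_dot g dg -> is_dot (fun t => f t - g t) (fun t => df t - dg t).
Proof.
move=> fdf /(is_dotZ (-1)) gdg.
by apply: eq_is_dot (is_dotD _ _ _ _ fdf gdg) => t _; rewrite scaleN1r.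
Qed.

Lemma is_dot_line {V : normedModType R} (x v : V) :
  is_dot (fun t => x + t *: v) (fun=> v).
Proof.
move=> t t0; apply: cvg_near_cst.
rewrite near_withinE /dnbhs near_withinE; near=> s => st _.
by rewrite opprD addrACA subrr add0r -scalerBl scalerA mulVf ?subr_eq0// scale1r.
Unshelve. all: by end_near. Qed.

Lemma is_dot_mxP {m n : nat} (f df : R -> 'M[R]_(m, n)) :
  is_dot f df <-> forall i j, is_dot (fun t => f t i j : R^o) (fun t => df t i j).
Proof.
have E i j s t : ((s - t)^-1 *: (f s - f t)) i j = (s - t)^-1 *: (f s i j - f t i j : R^o).
  by rewrite !mxE.
split=> [fdf i j t t0|fdf t t0].
  by under eq_fun do rewrite -E; move: i j; apply/cvg_mxP; exact: fdf.
by apply/cvg_mxP => i j; under eq_fun do rewrite E; exact: fdf.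
Qed.

(** The difference quotient of f g is that of f times g s, plus f t times that
    of g; the first product converges because g is continuous at t. *)
Lemma is_dot_mulmx {m n p : nat} (f df : R -> 'M[R]_(m, n))
    (g dg : R -> 'M[R]_(n, p)) :
  is_dot f df -> is_dot g dg ->
  is_dot (fun t => f t *m g t) (fun t => df t *m g t + f t *m dg t).
Proof.
move=> fdf gdg t t0.
apply: cvg_trans (cvgD (cvg_mulmx _ _ _ _ _ (fdf t t0) (is_dot_cvg _ _ _ gdg t0))
   (cvg_mulmx _ _ _ _ _ (cvg_cst (f t)) (gdg t t0))); apply: near_eq_cvg; near=> s.
by rewrite !fctE -scalemxAl -scalemxAr -scalerDr mulmxBl mulmxBr addrA subrK.
Unshelve. all: by end_near. Qed.

Lemma is_dot_trmx {m n : nat} (f df : R -> 'M[R]_(m, n)) :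
  is_dot f df -> is_dot (fun t => (f t)^T) (fun t => (df t)^T).
Proof.
move=> /is_dot_mxP fdf; apply/is_dot_mxP => i j.
by apply: eq_is_dot (fdf j i) => t _; rewrite mxE.
Qed.

(** This is the mean value theorem on [0, t].  The work is in passing from the
    half-line derivative to a two-sided derivative inside ]0, t[ and to one-sided
    continuity at the end points. *)
Lemma is_dot0_cst (f : R -> R^o) :
  is_dot f (fun=> 0) -> forall t, 0 <= t -> f t = f 0.
Proof.
move=> f0 t; rewrite le_eqVlt => /predU1P[<-//|t_gt0].
(* Around a positive point the half-line constraint is vacuous. *)
have dnbhs_pos (x : R) : 0 < x -> x^' `=>` within [set s : R | 0 <= s] x^' .
  move=> x0 A; rewrite /within /= => xA.
  have : \forall s \near x^', 0 <= s.
    apply: nbhs_dnbhs; near=> s; apply: ltW; near: s; exact: lt_nbhsr.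
  by apply: filterS2 xA => s h /h.
(* The limit defining [is_derive] is in the increment h = s - x. *)
have shiftx (x : R) : (h + x) @[h --> (0 : R)^'] --> x^'.
  move=> A xA; have : (h + x) @[h --> (0 : R)] --> (0 + x : R).
    by apply: cvgD; [exact: cvg_id|exact: cvg_cst].
  rewrite add0r => /(_ _ xA) xA0.
  suff : nbhs (0 : R) [set h | h != 0 -> A (h + x)] by [].
  apply: (@filterS _ (nbhs (0 : R)) _ _ _ _ xA0) => h /= hA h0.
  by apply: hA; rewrite -subr_eq0 addrK.
have fd (x : R) : x \in `]0, t[%R -> is_derive x 1 (f : R -> R) 0.
  rewrite in_itv/= => /andP[x0 _].
  have q : (h^-1 *: ((f \o shift x) (h *: 1) - f x)) @[h --> (0 : R)^'] --> (0 : R).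
    apply: cvg_trans (cvg_comp _ _ (shiftx x)
      (cvg_trans (cvg_app _ (dnbhs_pos x x0)) (f0 x (ltW x0)))).
    by apply: near_eq_cvg; near=> h; rewrite /= addrK [h *: 1]mulr1.
  by apply: DeriveDef; [apply/cvg_ex; exists 0|exact: cvg_lim q].
have fc : {within `[0, t], continuous (f : R -> R)}.
  apply/continuous_within_itvP => //; split.
  - move=> x x0t; apply: differentiable_continuous; apply/derivable1_diffP.
    by have [] := fd x x0t.
  - apply: cvg_trans (is_dot_cvg _ _ _ f0 (lexx 0)); apply: cvg_app.
    move=> A nA; suff : nbhs (0 : R) [set s | 0 < s -> A s] by [].
    apply: (@filterS _ (nbhs (0 : R)) _ _ _ _ nA) => s h s0.
    by apply: h; [rewrite gt_eqF|exact: ltW].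
  - apply: cvg_trans (is_dot_cvg _ _ _ f0 (ltW t_gt0)).
    apply: cvg_app; apply: cvg_trans (dnbhs_pos t t_gt0).
    by apply: within_subset => s st; rewrite lt_eqF.
have [c _] := MVT t_gt0 fd fc.
by rewrite mul0r => /subr0_eq.
Unshelve. all: by end_near. Qed.

Lemma is_dot0_cst_mx {m n : nat} (f : R -> 'M[R]_(m, n)) :
  is_dot f (fun=> 0) -> forall t, 0 <= t -> f t = f 0.
Proof.
move=> /is_dot_mxP f0 t t0; apply/matrixP => i j.
apply: (is_dot0_cst (fun t => f t i j)) => //.
by apply: eq_is_dot (f0 i j) => s _; rewrite ?mxE.
Qed.

(** The velocity has zero derivative, hence is v0; then x - (x0 + t v0) has zero
    derivative, hence keeps its initial value 0. *)
Lemma free_motionE (x0 v0 : 'cV[R]_3) (x : R -> 'cV[R]_3) :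
  is_free_motion x0 v0 x -> forall t, 0 <= t -> x t = x0 + t *: v0.
Proof.
move=> [v [xv v'0 x00 v00]] t t0.
have d0 : is_dot (fun t => x t - (x0 + t *: v0)) (fun=> 0).
  apply: eq_is_dot (is_dotB _ _ _ _ xv (is_dot_line x0 v0)) => // s s0.
  by rewrite (is_dot0_cst_mx _ v'0)// v00 subrr.
apply/subr0_eq; rewrite (is_dot0_cst_mx _ d0)//.
by rewrite x00 scale0r addr0 subrr.
Qed.

End HalfLineDerivative.

(** * Removing the rotation of the frame *)

Section RotatingFrame.
Context {R : realType}.

Lemma trmx_skew (w : 'cV[R]_3) : (skew w)^T = - skew w.
Proof.
apply/matrixP => i j; rewrite !mxE.
case: i => [[|[|[|//]]] ?]; case: j => [[|[|[|//]]] ?];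
  rewrite !eqE /= ?(mulr0, mulr1, subr0, sub0r, subrr, oppr0, opprK)//.
(* The remaining index pairs are equal modulo 3. *)
all: congr (- w _ _) || congr (w _ _); exact: val_inj.
Qed.

Lemma is_dot_skew (w dw : R -> 'cV[R]_3) :
  is_dot w dw -> is_dot (fun t => skew (w t)) (fun t => skew (dw t)).
Proof.
move=> /is_dot_mxP wdw; apply/is_dot_mxP => i j.
apply: eq_is_dot (is_dotB _ _ _ _ (is_dotZ _ _ _ (wdw (i + 1) 0))
  (is_dotZ _ _ _ (wdw (i + 2%:R) 0))) => t _; rewrite !mxE;
  by congr (_ - _); rewrite mulrC.
Qed.

(** The sum of squares under the root is x^T x. *)
Lemma enorm_orthogonal (Q : 'M[R]_3) (x : 'cV[R]_3) :
  Q^T *m Q = 1%:M -> enorm (Q *m x) = enorm x.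
Proof.
have E (y : 'cV[R]_3) : \sum_i y i 0 ^+ 2 = (y^T *m y) 0 0.
  by rewrite mxE; apply: eq_bigr => i _; rewrite mxE.
by move=> QQ; rewrite /enorm !E trmx_mul mulmxA -(mulmxA x^T) QQ mulmx1.
Qed.

(** The acceleration seen from the inertial frame, expressed in the rotating one:
    relative, Coriolis, centrifugal and Euler terms. *)
Definition absolute_acceleration (w dw x u a : 'cV[R]_3) : 'cV[R]_3 :=
  a + 2%:R *: cross w u + cross w (cross w x) + cross dw x.

Context {w dw : R -> 'cV[R]_3} {Q : R -> 'M[R]_3}.
Hypotheses (wdw : is_dot w dw) (rotQ : is_rotation_neg w Q).

Lemma is_dot_trmx_rotation :
  is_dot (fun t => (Q t)^T) (fun t => (Q t)^T *m skew (w t)).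
Proof.
case: rotQ => dQ _; apply: eq_is_dot (is_dot_trmx _ _ dQ) => // t _.
by rewrite trmx_mul raddfN /= trmx_skew opprK.
Qed.

(** The derivative of Q^T Q is Q^T W Q - Q^T W Q = 0. *)
Lemma rotationTK (t : R) : 0 <= t -> (Q t)^T *m Q t = 1%:M.
Proof.
case: rotQ => dQ Q0 t0.
have QQ0 : is_dot (fun t => (Q t)^T *m Q t) (fun=> 0).
  apply: eq_is_dot (is_dot_mulmx _ _ _ _ is_dot_trmx_rotation dQ) => // s _.
  by rewrite mulNmx mulmxN mulmxA subrr.
by rewrite (is_dot0_cst_mx _ QQ0)// Q0 trmx1 mulmx1.
Qed.

(** The transport formula: the velocity relative to the rotating frame is
    completed by cross w x. *)
Lemma is_dot_unrotate (x u : R -> 'cV[R]_3) : is_dot x u ->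
  is_dot (fun t => (Q t)^T *m x t) (fun t => (Q t)^T *m (u t + cross (w t) (x t))).
Proof.
move=> xu; apply: eq_is_dot (is_dot_mulmx _ _ _ _ is_dot_trmx_rotation xu) => // t _.
by rewrite -mulmxA mul_skew addrC mulmxDr.
Qed.

(** The transport formula is applied to u + cross w x.  The term cross w u occurs
    twice, once from differentiating cross w x and once from the transport: hence
    the factor 2 of the Coriolis term. *)
Lemma is_dot_unrotate_velocity (x u a : R -> 'cV[R]_3) :
  is_dot x u -> is_dot u a ->
  is_dot (fun t => (Q t)^T *m (u t + cross (w t) (x t)))
    (fun t => (Q t)^T *m absolute_acceleration (w t) (dw t) (x t) (u t) (a t)).
Proof.
move=> xu ua.
have wx : is_dot (fun t => cross (w t) (x t))
    (fun t => cross (dw t) (x t) + cross (w t) (u t)).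
  by apply: eq_is_dot (is_dot_mulmx _ _ _ _ (is_dot_skew _ _ wdw) xu) => t _;
    rewrite !mul_skew.
apply: eq_is_dot (is_dot_unrotate _ _ (is_dotD _ _ _ _ ua wx)) => // t _.
congr (_ *m _); rewrite /absolute_acceleration -!(mul_skew (w t)) mulmxDr.
by rewrite scaler_nat mulr2n !addrA -!addrA; congr (_ + _); rewrite addrCA;
  congr (_ + _); rewrite addrC -!addrA.
Qed.

End RotatingFrame.

(** * Barycenter of two particles *)

Section Barycenter.
Context {R : realType}.
Implicit Types (m : R) (x y : 'cV[R]_3).

Lemma barycenterD m1 m2 x1 x2 y1 y2 :
  barycenter m1 m2 (x1 + y1) (x2 + y2) =
  barycenter m1 m2 x1 x2 + barycenter m1 m2 y1 y2.
Proof. by rewrite /barycenter -scalerDr !scalerDr addrACA. Qed.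

Lemma mulmx_barycenter m1 m2 (M : 'M[R]_3) x1 x2 :
  M *m barycenter m1 m2 x1 x2 = barycenter m1 m2 (M *m x1) (M *m x2).
Proof. by rewrite /barycenter -scalemxAr mulmxDr -!scalemxAr. Qed.

Lemma is_dot_barycenter m1 m2 (x1 x2 u1 u2 : R -> 'cV[R]_3) :
  is_dot x1 u1 -> is_dot x2 u2 ->
  is_dot (fun t => barycenter m1 m2 (x1 t) (x2 t))
    (fun t => barycenter m1 m2 (u1 t) (u2 t)).
Proof. by move=> xu1 xu2; apply/is_dotZ/is_dotD; exact: is_dotZ. Qed.

Lemma barycenter_left m1 m2 x1 x2 : m1 + m2 != 0 ->
  x1 = barycenter m1 m2 x1 x2 - (m2 / (m1 + m2)) *: (x2 - x1).
Proof. by move=> m0; apply/matrixP => i j; rewrite !mxE; field. Qed.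

Lemma barycenter_right m1 m2 x1 x2 : m1 + m2 != 0 ->
  x2 = barycenter m1 m2 x1 x2 + (m1 / (m1 + m2)) *: (x2 - x1).
Proof. by move=> m0; apply/matrixP => i j; rewrite !mxE; field. Qed.

End Barycenter.

(** * The two-body problem in the rotating frame *)

Theorem mainTheorem20 (R : realType)
  (m1 m2 : R) (hm1 : 0 < m1) (hm2 : 0 < m2)
  (w dw : R -> 'cV[R]_3) (hw : is_dot w dw)
  (r1 v1 a1 r2 v2 a2 : R -> 'cV[R]_3)
  (hr1 : is_dot r1 v1) (hv1 : is_dot v1 a1)
  (hr2 : is_dot r2 v2) (hv2 : is_dot v2 a2)
  (F12 F21 : R -> 'cV[R]_3)
  (motion1 : forall t : R, 0 <= t ->
    m1 *: (a1 t + 2%:R *: cross (w t) (v1 t) + cross (w t) (cross (w t) (r1 t))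
           + cross (dw t) (r1 t)) = F12 t)
  (motion2 : forall t : R, 0 <= t ->
    m2 *: (a2 t + 2%:R *: cross (w t) (v2 t) + cross (w t) (cross (w t) (r2 t))
           + cross (dw t) (r2 t)) = F21 t)
  (r10 v10 r20 v20 : 'cV[R]_3)
  (init_r1 : r1 0 = r10) (init_v1 : v1 0 = v10)
  (init_r2 : r2 0 = r20) (init_v2 : v2 0 = v20)
  (action_reaction : forall t : R, 0 <= t -> F12 t + F21 t = 0)
  (central : forall t : R, 0 <= t -> cross (F12 t) (r2 t - r1 t) = 0)
  (noncollision : forall t : R, 0 <= t -> r2 t - r1 t <> 0)
  (F : R -> R -> R)
  (F21E : forall t : R, 0 <= t ->
    F21 t = F t (enorm (r2 t - r1 t)) *:
              ((enorm (r2 t - r1 t))^-1 *: (r2 t - r1 t)))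
  (Q : R -> 'M[R]_3) (hQ : is_rotation_neg w Q)
  (rc0 vc0 r0 v0 : 'cV[R]_3)
  (rc0E : rc0 = barycenter m1 m2 r10 r20)
  (vc0E : vc0 = barycenter m1 m2 v10 v20)
  (r0E : r0 = r20 - r10) (v0E : v0 = v20 - v10)
  (rcs rs : R -> 'cV[R]_3)
  (hrcs : is_free_motion rc0 (vc0 + cross (w 0) rc0) rcs)
  (hrs : is_the_solution
           (is_central_motion (reduced_mass m1 m2) F r0 (v0 + cross (w 0) r0))
           rs) :
  forall t : R, 0 <= t ->
    [/\ rcs t = rc0 + t *: (vc0 + cross (w 0) rc0),
        barycenter m1 m2 (r1 t) (r2 t) = rotate Q rcs t,
        r2 t - r1 t = rotate Q rs t,
        r1 t = rotate Q (fun s => rcs s - (m2 / (m1 + m2)) *: rs s) t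
      & r2 t = rotate Q (fun s => rcs s + (m1 / (m1 + m2)) *: rs s) t].
Proof.
have m1_neq0 : m1 != 0 by rewrite gt_eqF.
have m2_neq0 : m2 != 0 by rewrite gt_eqF.
have M_neq0 : m1 + m2 != 0 by rewrite gt_eqF// addr_gt0.
have Q0 : Q 0 = 1%:M by case: hQ.
have QTQ := rotationTK hQ.
have QQT t : 0 <= t -> Q t *m (Q t)^T = 1%:M by move=> /QTQ /mulmx1C.
(* Positions and velocities in the inertial frame. *)
pose y1 t := (Q t)^T *m r1 t; pose y2 t := (Q t)^T *m r2 t.
pose u1 t := (Q t)^T *m (v1 t + cross (w t) (r1 t)).
pose u2 t := (Q t)^T *m (v2 t + cross (w t) (r2 t)).
have y1u1 : is_dot y1 u1 := is_dot_unrotate hQ _ _ hr1.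
have y2u2 : is_dot y2 u2 := is_dot_unrotate hQ _ _ hr2.
(* Both accelerations are expressed by F21, since F12 = - F21. *)
have u1' : is_dot u1 (fun t => - m1^-1 *: ((Q t)^T *m F21 t)).
  apply: eq_is_dot (is_dot_unrotate_velocity hw hQ _ _ _ hr1 hv1) => // t t0.
  rewrite -(addr0_eq (action_reaction t t0)) mulmxN scalerN scaleNr opprK.
  by rewrite -motion1// -scalemxAr scalerA mulVf// scale1r.
have u2' : is_dot u2 (fun t => m2^-1 *: ((Q t)^T *m F21 t)).
  apply: eq_is_dot (is_dot_unrotate_velocity hw hQ _ _ _ hr2 hv2) => // t t0.
  by rewrite -motion2// -scalemxAr scalerA mulVf// scale1r.
(* The two contributions of F21 to the barycenter cancel. *)
have y_free : is_free_motion rc0 (vc0 + cross (w 0) rc0)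
    (fun t => barycenter m1 m2 (y1 t) (y2 t)).
  exists (fun t => barycenter m1 m2 (u1 t) (u2 t)); split.
  - exact: is_dot_barycenter.
  - apply: eq_is_dot (is_dot_barycenter m1 m2 _ _ _ _ u1' u2') => // t t0.
    by rewrite /barycenter !scalerA mulrN !divff// -scalerDl addNr scale0r scaler0.
  - by rewrite /y1 /y2 Q0 trmx1 !mul1mx init_r1 init_r2.
  - rewrite /u1 /u2 Q0 trmx1 !mul1mx init_v1 init_v2 init_r1 init_r2.
    by rewrite barycenterD vc0E rc0E -!mul_skew mulmx_barycenter.
have y_central : is_central_motion (reduced_mass m1 m2) F r0
    (v0 + cross (w 0) r0) (fun t => y2 t - y1 t).
  split=> [t t0|].
    rewrite -mulmxBr => /(congr1 (mulmx (Q t))).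
    by rewrite mulmxA QQT// mul1mx mulmx0; exact: noncollision.
  exists (fun t => u2 t - u1 t); split.
  - exact: is_dotB.
  - apply: eq_is_dot (is_dotB _ _ _ _ u2' u1') => // t t0.
    rewrite -mulmxBr enorm_orthogonal ?trmxK ?QQT// F21E//.
    rewrite -scalerBl -!scalemxAr [LHS]scalerA; congr (_ *: _).
    by rewrite /reduced_mass; field; rewrite m1_neq0 m2_neq0 M_neq0.
  - by rewrite /y1 /y2 Q0 trmx1 !mul1mx init_r1 init_r2.
  - rewrite /u1 /u2 Q0 trmx1 !mul1mx init_v1 init_v2 init_r1 init_r2.
    by rewrite v0E r0E -!mul_skew mulmxBr opprD addrACA.
move=> t t0.
have rcsE : rcs t = barycenter m1 m2 (y1 t) (y2 t).
  by rewrite (free_motionE _ _ _ hrcs)// (free_motionE _ _ _ y_free).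
have rsE : rs t = y2 t - y1 t.
  by case: hrs => _ /(_ _ y_central t t0) ->.
have Qy1 : r1 t = Q t *m y1 t by rewrite mulmxA QQT// mul1mx.
have Qy2 : r2 t = Q t *m y2 t by rewrite mulmxA QQT// mul1mx.
rewrite /rotate rcsE rsE; split.
- by rewrite -rcsE (free_motionE _ _ _ hrcs).
- by rewrite mulmx_barycenter -Qy1 -Qy2.
- by rewrite mulmxBr -Qy1 -Qy2.
- by rewrite -barycenter_left.
- by rewrite -barycenter_right.
Qed.
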